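(* Let $G_1$ be an $r_1$-regular graph on $n_1$ vertices and $m_1$ edges, and $G_2$ be a graph on $n_2$ vertices. Let $\lambda_1(A_\alpha(G_1))\ge\cdots\ge\lambda_{n_1}(A_\alpha(G_1))$ be the eigenvalues of $A_\alpha(G_1)$. 1. If $r_1=1$, then for each $\alpha\in[0,1]$, $$\psi_{A_{\alpha}(G_1 \underline{\vee} G_2)}(x) =(x-\alpha) \cdot \psi_{A_{\alpha}(G_2)}(x- \alpha)\cdot \Big( x^2 -\alpha (3+n_2)x +({\alpha}^2n_2 +4\alpha -2) - (1-\alpha)^2(x-\alpha) \Gamma_{A_{\alpha}(G_2)}(x-\alpha) \Big).$$ 2. If $r_1\ge2$, then for each $\alpha\in[0,1]$, \begin{multline*} \psi_{A_{\alpha}(G_1 \underline{\vee} G_2)}(x) =\big(x-2\alpha -\alpha n_2\big)^{m_1 -n_1} \cdot \psi_{A_{\alpha}(G_2)}(x- \alpha m_1)\\ \cdot \Big( x^2 -\alpha (2+r_1+n_2)x +r_1({\alpha}^2n_2 +4\alpha -2) - m_1(1-\alpha)^2(x-\alpha r_1) \Gamma_{A_{\alpha}(G_2)}(x-\alpha m_1) \Big)\\ \cdot \prod_{i=2}^{n_1}\Big(x^2 -\alpha (2+r_1+n_2)x + r_1({\alpha}^2n_2 +3\alpha -1) - (1-\alpha)\lambda_i\big(A_{\alpha}(G_1)\big)\Big). \end{multline*}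
   Context: All graphs are simple, undirected, finite and connected. For a graph $G$ with adjacency matrix $A(G)$ and diagonal degree matrix $D(G)$, and $\alpha\in[0,1]$, $A_{\alpha}(G)=\alpha D(G)+(1-\alpha)A(G)$. For a square matrix $M$ of order $n$, $\psi_M(x)=\det(xI_n-M)$, and $\Gamma_M(x)=\mathbf{1}_n^T(xI_n-M)^{-1}\mathbf{1}_n$, where $\mathbf{1}_n$ is the all-ones column vector. The subdivision graph $S(G)$ is obtained from $G$ by inserting a new vertex into every edge. The subdivision-edge join $G_1 \underline{\vee} G_2$ is the graph obtained from $S(G_1)$ and $G_2$ by joining every inserted vertex of $S(G_1)$ (one per edge of $G_1$) with every vertex of $G_2$. The identities are identities of rational functions in $x$. *)

(* Defs.v *)
From HB Require Import structures.
From mathcomp Require Import all_boot all_order all_algebra fraction.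
From mathcomp Require Import spectral complex.

Set Implicit Arguments.
Unset Strict Implicit.
Unset Printing Implicit Defensive.

Import Order.TTheory GRing.Theory Num.Theory.
Local Open Scope ring_scope.

Record sgraph := SGraph {
  vertex :> finType;
  adj : rel vertex;
  adj_sym : symmetric adj;
  adj_irrefl : irreflexive adj }.

Section Graphs.
Variable G : sgraph.

Definition connected_graph : Prop :=
  (0 < #|G|)%N /\ (forall u v : G, connect (@adj G) u v).

Definition degree (v : G) : nat := #|[set w : G | adj v w]|.

Definition regular (r : nat) : Prop := forall v : G, degree v = r.

Definition edge_set : {set {set G}} :=
  [set e : {set G} | [exists u, exists v, adj u v && (e == [set u; v])]].

Definition edge : finType := {e : {set G} | e \in edge_set}.

(* Vertices: inl v for v in G, inr e for the vertex inserted into e. *)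
Definition subdivision_adj (a b : (G + edge)%type) : bool :=
  match a, b with
  | inl v, inr e | inr e, inl v => v \in val e
  | _, _ => false
  end.

Lemma subdivision_adj_sym : symmetric subdivision_adj.
Proof. by case=> a [] b. Qed.

Lemma subdivision_adj_irrefl : irreflexive subdivision_adj.
Proof. by case. Qed.

Definition subdivision : sgraph :=
  SGraph subdivision_adj_sym subdivision_adj_irrefl.

End Graphs.

Section SubdivisionEdgeJoin.
Variables G1 G2 : sgraph.

Definition inserted (a : subdivision G1) : bool :=
  if a is inr _ then true else false.

Definition sejoin_adj (a b : (subdivision G1 + G2)%type) : bool :=
  match a, b with
  | inl s, inl t => adj s t
  | inr u, inr v => adj u v
  | inl s, inr _ | inr _, inl s => inserted s
  end.

Lemma sejoin_adj_sym : symmetric sejoin_adj.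
Proof. by case=> a [] b //; apply: adj_sym. Qed.

Lemma sejoin_adj_irrefl : irreflexive sejoin_adj.
Proof. by case=> a; apply: adj_irrefl. Qed.

Definition sejoin : sgraph := SGraph sejoin_adj_sym sejoin_adj_irrefl.

End SubdivisionEdgeJoin.

Section Matrices.
Variables (R : rcfType) (G : sgraph).

Definition adj_mx : 'M[R]_#|G| :=
  \matrix_(i, j) (adj (enum_val i) (enum_val j))%:R.

Definition deg_mx : 'M[R]_#|G| :=
  diag_mx (\row_i (degree (enum_val i))%:R).

Definition alpha_mx (alpha : R) : 'M[R]_#|G| :=
  alpha *: deg_mx + (1 - alpha) *: adj_mx.

End Matrices.

(* The eigenvalues with multiplicity, in nonincreasing order. *)
Definition is_spectrum (R : rcfType) (n : nat) (M : 'M[R]_n) (s : seq R) : Prop :=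
  sorted >=%R s /\ char_poly M = \prod_(l <- s) ('X - l%:P).

Definition ratfunX (R : rcfType) : {fraction {poly R}} := tofrac 'X.

Definition ratfunC (R : rcfType) : R -> {fraction {poly R}} :=
  @tofrac {poly R} \o polyC.

(* psi M y and Gamma M y are the values of psi_M and Gamma_M at a rational
   function y: y = ratfunX R gives the functions themselves, and
   y = ratfunX R - ratfunC c their translates x |-> x - c. By resolvent_unit
   below, invmx in Gamma is then a genuine inverse. *)
Definition psi (R : rcfType) (n : nat) (M : 'M[R]_n)
    (y : {fraction {poly R}}) : {fraction {poly R}} :=
  \det (y%:M - map_mx (@ratfunC R) M).

Definition Gamma (R : rcfType) (n : nat) (M : 'M[R]_n)
    (y : {fraction {poly R}}) : {fraction {poly R}} :=
  let one_n : 'cV[{fraction {poly R}}]_n := const_mx 1 in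
  (one_n^T *m invmx (y%:M - map_mx (@ratfunC R) M) *m one_n) 0 0.

Lemma psiE (R : rcfType) n (M : 'M[R]_n) (c : R) :
  psi M (ratfunX R - ratfunC c) = tofrac (char_poly M \Po ('X - c%:P)).
Proof.
rewrite /psi /char_poly -(det_map_mx (comp_poly ('X - c%:P))) -det_map_mx.
congr (\det _); apply/matrixP=> i j; rewrite !mxE rmorphB rmorphMn /= comp_polyX.
by rewrite comp_polyC !rmorphB /= rmorphMn /= rmorphB.
Qed.

Lemma resolvent_unit (R : rcfType) n (M : 'M[R]_n) (c : R) :
  (ratfunX R - ratfunC c)%:M - map_mx (@ratfunC R) M \in unitmx.
Proof.
rewrite unitmxE -/(psi M _) psiE unitfE tofrac_eq0 comp_poly2_eq0.
  by rewrite monic_neq0 // char_poly_monic.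
by rewrite size_XsubC.
Qed.

Lemma alpha_mx_sym (R : rcfType) (G : sgraph) (alpha : R) :
  (alpha_mx G alpha)^T = alpha_mx G alpha.
Proof.
apply/matrixP=> i j; rewrite !mxE adj_sym.
by rewrite eq_sym; case: eqVneq => [->|].
Qed.

Lemma symmetric_has_spectrum (R : rcfType) n (M : 'M[R]_n) :
  M^T = M -> exists s, is_spectrum M s.
Proof.
move=> Msym; pose f := real_complex R; pose N := map_mx f M.
have Nherm : N \is hermsymmx.
  apply/is_hermitianmxP; rewrite expr0 scale1r.
  apply/matrixP=> i j; rewrite !mxE -[in LHS]Msym mxE.
  by rewrite (CrealP _) // complex_real.
have dreal := hermitian_spectral_diag_real Nherm.
have /orthomx_spectralP Ndec := hermitian_normalmx Nherm.
set P := spectralmx N in Ndec; set d := spectral_diag N in Ndec dreal.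
have Pu : P \in unitmx by apply: spectral_unit.
pose t := [seq complex.Re (d 0 i) | i <- enum 'I_n].
have td : char_poly M = \prod_(l <- t) ('X - l%:P).
  apply: (map_poly_inj f); rewrite map_char_poly -/N.
  have -> : char_poly N = char_poly (diag_mx d).
    rewrite /char_poly /char_poly_mx [in X in _ - X]Ndec !map_mxM.
    have XE : 'X%:M = map_mx polyC (invmx P) *m 'X%:M *m map_mx polyC P.
      by rewrite scalar_mxC -mulmxA -map_mxM mulVmx // map_mx1 mulmx1.
    rewrite [in LHS]XE -mulmxBl -mulmxBr !det_mulmx mulrAC -det_mulmx -map_mxM mulVmx //.
    by rewrite map_mx1 det1 mul1r.
  rewrite char_poly_trig ?diag_mx_is_trig // big_map rmorph_prod big_enum /=.
  apply: eq_bigr => i _; rewrite map_polyXsubC !mxE eqxx mulr1n.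
  have dr : d 0 i \is Num.real by have /mxOverP := dreal; apply.
  by rewrite -[in LHS](RRe_real dr).
exists (sort >=%R t); split.
  by apply: sort_sorted => x y; apply: le_total.
by rewrite td; apply: perm_big; rewrite perm_sym perm_sort.
Qed.

(* Main.v *)
(** Write p, q and M for the diagonal blocks of x - A_alpha on old vertices,
inserted vertices and G2; p and q are scalar since G1 is regular. A Schur
complement at M turns the join with G2 into a rank-one perturbation
(1-alpha)^2 Gamma J of the inserted block. A second one at p leaves an m1 x m1
matrix N - (1-alpha)^2 Gamma J, where N = q - (1-alpha)^2/p B^T B and B is the
incidence matrix. As N has constant row sums s, N - g J = N (1 - (g/s) J), which
splits off the Gamma factor. Since p^n1 q^n1 det N = q^m1 det (p q -
(1-alpha)^2 B B^T) and B B^T = r1 + A(G1), the rest is the characteristic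
polynomial of A_alpha(G1), whose largest eigenvalue is r1. If r1 = 1, then
G1 = K_2 and N is 1 x 1. *)

Require Import Defs.
From HB Require Import structures.
From mathcomp Require Import all_boot all_order all_algebra fraction perm.
From mathcomp Require Import ring.

Set Implicit Arguments.
Unset Strict Implicit.
Unset Printing Implicit Defensive.

Import Order.TTheory GRing.Theory Num.Theory.
Local Open Scope ring_scope.

(** * Determinants: reindexing, Schur complements and rank-one perturbations *)

Lemma det_mxsub_bij (K : comPzRingType) n m (h : 'I_n -> 'I_m) (A : 'M[K]_m) :
  bijective h -> \det (mxsub h h A) = \det A.
Proof.
move=> hb; have nm : n = m by rewrite -[n]card_ord -[m]card_ord; apply: bij_eq_card hb.
(* Once the two orders are identified, [h] is a permutation applied to both rows and columns, and
   its two signs cancel. *)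
case: m / nm h hb A => h /bij_inj hi A.
have -> : mxsub h h A = row_perm (perm hi) (col_perm (perm hi) A).
  by apply/matrixP=> i j; rewrite !mxE !permE.
by rewrite row_permE col_permE !det_mulmx !det_perm odd_permV mulrCA
  -signr_addb addbb mulr1.
Qed.

Lemma det_schur_dr (K : comUnitRingType) n m (A : 'M[K]_n) B C (D : 'M[K]_m) :
  D \in unitmx ->
  \det (block_mx A B C D) = \det D * \det (A - B *m invmx D *m C).
Proof.
move=> Du.
have -> : block_mx A B C D =
    block_mx 1%:M (B *m invmx D) 0 1%:M *m
    block_mx (A - B *m invmx D *m C) 0 C D.
  by rewrite mulmx_block !mul1mx !mul0mx mulmxKV // subrK !add0r.
by rewrite det_mulmx det_ublock det_lblock !det1 !mul1r mulrC.
Qed.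

Lemma det_schur_ul (K : fieldType) n m (p : K) B C (D : 'M[K]_m) :
  p != 0 ->
  \det (block_mx (p%:M : 'M_n) B C D) = p ^+ n * \det (D - p^-1 *: (C *m B)).
Proof.
move=> p0.
have -> : block_mx (p%:M : 'M_n) B C D =
    block_mx (p%:M : 'M_n) 0 C (D - p^-1 *: (C *m B)) *m
    block_mx 1%:M (p^-1 *: B) 0 1%:M.
  rewrite mulmx_block !mulmx1 !mul0mx !mulmx0 addr0 mul_scalar_mx scalerA mulfV //.
  by rewrite scale1r !addr0 -scalemxAr addrC subrK.
by rewrite det_mulmx det_ublock det_lblock !det1 !mulr1 det_scalar.
Qed.

(** Both sides are [q ^+ n] times the determinant of the block matrix with rows [p, B] and [C, q],
    computed by the Schur complement at [p] and then at [q]. Keeping [q ^+ n] on the left makes the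
    identity free of any comparison of [n] and [m]. *)
Lemma det_scalar_sub_mulC (K : fieldType) n m (p q : K)
    (B : 'M_(n, m)) (C : 'M_(m, n)) :
  p != 0 -> q != 0 ->
  q ^+ n * (p ^+ n * \det (q%:M - p^-1 *: (C *m B))) =
  q ^+ m * \det ((p * q)%:M - B *m C).
Proof.
move=> p0 q0; rewrite -det_schur_ul // det_schur_dr; last first.
  by rewrite unitmxE det_scalar unitrX // unitfE.
rewrite det_scalar mulrCA -detZ scalerBr scale_scalar_mx (mulrC q).
rewrite invmx_scalar -mulmxA mul_scalar_mx -scalemxAr scalerA mulfV //.
by rewrite scale1r.
Qed.

(** A constant matrix is a column times a row, so exchanging the two factors leaves a determinant of
    order 1. *)
Lemma det1_sub_const (K : fieldType) m (c : K) :
  \det (1%:M - const_mx c : 'M_m) = 1 - c * m%:R.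
Proof.
have := @det_scalar_sub_mulC K 1 m 1 1 (const_mx 1) (const_mx c)
  (oner_neq0 _) (oner_neq0 _).
rewrite !expr1n !mul1r invr1 scale1r => H.
have -> : const_mx c = const_mx c *m (const_mx 1 : 'rV_m) :> 'M[K]_m.
  by apply/matrixP=> i j; rewrite !mxE big_ord1 !mxE mulr1.
rewrite H det_mx11 !mxE eqxx mulr1n; congr (_ - _).
under eq_bigr do rewrite !mxE mul1r.
by rewrite sumr_const card_ord mulr_natr.
Qed.

Lemma det_sub_const (K : fieldType) m (N : 'M[K]_m) (s g : K) :
  s != 0 -> N *m const_mx 1 = const_mx s :> 'M_(m, m) ->
  \det (N - const_mx g) = \det N * (1 - g / s * m%:R).
Proof.
move=> s0 Ns; rewrite -det1_sub_const -det_mulmx mulmxBr mulmx1.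
have constE c : const_mx c = c *: const_mx 1 :> 'M[K]_m.
  by apply/matrixP=> i j; rewrite !mxE mulr1.
by rewrite (constE (g / s)) -scalemxAr Ns (constE s) scalerA divfK // -constE.
Qed.

(** * Counting edges, degrees and incidences *)

Section Counting.
Variable G : sgraph.

Lemma degreeE (v : G) : degree v = (\sum_(w : G) adj v w)%N.
Proof. by rewrite /degree -sum1dep_card big_mkcond; apply: eq_bigr => w _; case: adj. Qed.

Lemma edgeP (e : edge G) : exists u v : G, adj u v /\ val e = [set u; v].
Proof.
case: e => e /=; rewrite inE => /existsP[u /existsP[v /andP[uv /eqP->]]].
by exists u, v.
Qed.

Lemma set2_edge (u v : G) : adj u v -> [set u; v] \in edge_set G.
Proof.
move=> uv; rewrite inE; apply/existsP; exists u; apply/existsP; exists v.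
by rewrite uv eqxx.
Qed.

Lemma adj_neq (u v : G) : adj u v -> u != v.
Proof. by apply: contraTneq => ->; rewrite adj_irrefl. Qed.

Lemma card_edge (e : edge G) : #|val e| = 2%N.
Proof. by have [u [v [/adj_neq uv ->]]] := edgeP e; rewrite cards2 uv. Qed.

Lemma card_edges : #|edge G| = #|edge_set G|.
Proof. by rewrite card_sig; apply: eq_card. Qed.

Lemma edge_two (u v : G) (e : edge G) :
  u != v -> u \in val e -> v \in val e -> adj u v /\ val e = [set u; v].
Proof.
have [s [t [st ->]]] := edgeP e; rewrite !inE => uv.
case/orP=> /eqP Eu; case/orP=> /eqP Ev; subst.
- by rewrite eqxx in uv.
- by [].
- by rewrite adj_sym setUC.
- by rewrite eqxx in uv.
Qed.

(** Gives the off-diagonal entries of [B B^T]: by [edge_two], an edge is determined by two distinct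
    vertices on it. *)
Lemma sum_edges_two (u v : G) : u != v ->
  (\sum_(e : edge G) (u \in val e) * (v \in val e) = adj u v)%N.
Proof.
move=> uv; case uvA: (adj u v); last first.
  apply: big1 => e _; case: (boolP (u \in val e)) => // ue.
  case: (boolP (v \in val e)) => // ve.
  by have [] := edge_two uv ue ve; rewrite uvA.
pose e0 : edge G := Sub [set u; v] (set2_edge uvA).
rewrite (bigD1 e0) //= !inE !eqxx orbT big1 // => e ee0.
case: (boolP (u \in val e)) => // ue; case: (boolP (v \in val e)) => // ve.
have [_ eE] := edge_two uv ue ve.
by case/eqP: ee0; apply: val_inj.
Qed.

(** Each edge through [u] has exactly one other end, so summing [sum_edges_two] over the possible
    other ends counts the neighbours of [u]. *)
Lemma sum_edges_at (u : G) : (\sum_(e : edge G) (u \in val e) = degree u)%N.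
Proof.
have inE2 (e : edge G) : (u \in val e) =
    (\sum_(v | v != u) (u \in val e) * (v \in val e))%N :> nat.
  case: (boolP (u \in val e)) => [ue|_]; last by rewrite big1.
  have := card_edge e; rewrite -sum1_card (bigD1 u) //= => /eqP.
  rewrite eqSS => /eqP {1}<-; rewrite big_mkcondl.
  by apply: eq_bigr => v _; rewrite mul1n; case: (v \in _).
under eq_bigr do rewrite inE2.
rewrite exchange_big degreeE [RHS](bigD1 u) //= adj_irrefl add0n.
by apply: eq_bigr => v vu; rewrite sum_edges_two // eq_sym.
Qed.

Lemma handshake : (\sum_(v : G) degree v = 2 * #|edge G|)%N.
Proof.
under eq_bigr do rewrite -sum_edges_at.
rewrite exchange_big mulnC -sum_nat_const; apply: eq_bigr => e _.
rewrite -(card_edge e) -sum1_card [RHS]big_mkcond.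
by apply: eq_bigr => v _; case: (_ \in _).
Qed.

Lemma handshake_regular r : regular G r -> (#|G| * r = 2 * #|edge G|)%N.
Proof. by move=> reg; rewrite -handshake -sum_nat_const; apply: eq_bigr => v _. Qed.

(** A vertex and its only neighbour form a set closed under adjacency, which connectedness makes the
    whole graph. The edge count follows by the handshake identity. *)
Lemma connected_1_regular : connected_graph G -> regular G 1%N ->
  #|G| = 2%N /\ #|edge G| = 1%N.
Proof.
case=> /card_gt0P[u _] conn reg.
have [w uw] : exists w, [set w : G | adj u w] = [set w].
  by apply/cards1P; rewrite -/(degree u) reg.
have uwA : adj u w by have := set11 w; rewrite -uw inE.
have [z wz] : exists z, [set z : G | adj w z] = [set z].
  by apply/cards1P; rewrite -/(degree w) reg.
have zu : u = z by apply/set1P; rewrite -wz inE adj_sym.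
subst z.
have cl : closed (@adj G) [set u; w].
  apply: intro_closed => [|a b ab]; first by apply/sym_connect_sym/adj_sym.
  rewrite !inE => /orP[]/eqP Ea; subst a.
    have /set1P-> : b \in [set w] by rewrite -uw inE.
    by rewrite eqxx orbT.
  have /set1P-> : b \in [set u] by rewrite -wz inE.
  by rewrite eqxx.
have G2 : #|G| = 2%N.
  have := cards2 u w; rewrite (adj_neq uwA) /= => <-.
  by apply: eq_card => a; rewrite -(closed_connect cl (conn u a)) !inE eqxx.
split=> //; have := handshake_regular reg.
by rewrite G2 muln1 mul2n => /(congr1 half); rewrite doubleK.
Qed.

(** Ensures that the truncated subtraction in the exponent [m1 - n1] is a true difference when
    [2 <= r]. *)
Lemma card_le_edges r : (2 <= r)%N -> regular G r -> (#|G| <= #|edge G|)%N.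
Proof.
move=> r2 /handshake_regular hs.
by rewrite -(leq_pmul2l (isT : 0 < 2)%N) -hs mulnC leq_mul.
Qed.

End Counting.

(** Registered as a ring morphism, [ratfunC] carries matrix products and characteristic polynomials
    over [R] to the field of rational functions. *)
HB.instance Definition _ (R : rcfType) :=
  GRing.RMorphism.copy (@ratfunC R) (@tofrac {poly R} \o polyC).

Lemma sum_enum_val (V : nmodType) (T : finType) (F : T -> V) :
  \sum_(i < #|T|) F (enum_val i) = \sum_x F x.
Proof.
rewrite [RHS](reindex (fun i : 'I_#|T| => enum_val i)) //.
exact/onW_bij/enum_val_bij.
Qed.

(** * The unsigned incidence matrix and its row and column sums *)

Section Incidence.
Variables (R : rcfType) (G : sgraph).

Definition inc_mx : 'M[R]_(#|G|, #|edge G|) :=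
  \matrix_(i < #|G|, j < #|edge G|)
    (enum_val i \in val (enum_val j : edge G))%:R.

(** The diagonal counts the edges at a vertex; an entry off the diagonal counts the edges through
    two distinct vertices. *)
Lemma inc_mul_tr : inc_mx *m inc_mx^T = deg_mx R G + adj_mx R G.
Proof.
apply/matrixP=> i j; rewrite !mxE.
under eq_bigr do rewrite !mxE -natrM.
rewrite -natr_sum (sum_enum_val (fun e : edge G =>
  (enum_val i \in val e) * (enum_val j \in val e))%N).
have [->|ij] := eqVneq i j; last first.
  by rewrite sum_edges_two ?add0r // (inj_eq enum_val_inj).
rewrite adj_irrefl addr0 -sum_edges_at mulr1n; congr (_%:R).
by apply: eq_bigr => e _; case: (_ \in _).
Qed.

(** The 2 counts the ends of an edge. Combined with the factor [r] of [inc_mul_const], it gives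
    [B^T B] the constant row sum [2 r]. *)
Lemma tr_inc_mul_const m (c : R) :
  inc_mx^T *m (const_mx c : 'M_(_, m)) = const_mx (2 * c).
Proof.
apply/matrixP=> i j; rewrite !mxE; under eq_bigr do rewrite !mxE.
rewrite -mulr_suml -natr_sum (sum_enum_val
  (fun v : G => v \in val (enum_val i) : nat)).
by rewrite -(card_edge (enum_val i)) -sum1_card [in RHS]big_mkcond; congr (_%:R * _);
  apply: eq_bigr => v _; case: (_ \in _).
Qed.

Lemma inc_mul_const r m (c : R) : regular G r ->
  inc_mx *m (const_mx c : 'M_(_, m)) = const_mx (r%:R * c).
Proof.
move=> reg; apply/matrixP=> i j; rewrite !mxE; under eq_bigr do rewrite !mxE.
rewrite -mulr_suml -natr_sum (sum_enum_val
  (fun e : edge G => enum_val i \in val e : nat)).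
by rewrite sum_edges_at reg.
Qed.

Lemma deg_mx_regular r : regular G r -> deg_mx R G = r%:R%:M.
Proof. by move=> reg; apply/matrixP=> i j; rewrite !mxE reg. Qed.

End Incidence.

Lemma alpha_resolventE (R : rcfType) (G : sgraph) (alpha : R)
    (y : {fraction {poly R}}) i j :
  (y%:M - map_mx (@ratfunC R) (alpha_mx G alpha)) i j =
  (y - ratfunC alpha * (degree (enum_val i))%:R) *+ (i == j)
  + (ratfunC alpha - 1) * (adj (enum_val i) (enum_val j))%:R.
Proof.
rewrite !mxE; case: eqP => _; rewrite ?mulr1n ?mulr0n.
  by rewrite rmorphD !rmorphM rmorphB rmorph1 !rmorph_nat /=; ring.
by rewrite rmorphD !rmorphM rmorphB rmorph1 rmorph0 rmorph_nat /=; ring.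
Qed.

(** * The matrix of the join in block form *)

Section BlockForm.
Variables G1 G2 : sgraph.
Local Notation J := (sejoin G1 G2).

Lemma degree_sejoin_old (v : G1) : @degree J (inl (inl v)) = degree v.
Proof.
rewrite degreeE -sum_edges_at !big_sumType /=.
by rewrite !(big1 _ _ (fun _ => 0%N)) // ?add0n ?addn0.
Qed.

Lemma degree_sejoin_inserted (e : edge G1) :
  @degree J (inl (inr e)) = (2 + #|G2|)%N.
Proof.
rewrite degreeE !big_sumType /= sum1_card -(card_edge e) -[#|val e|]sum1_card.
rewrite [X in (_ + X + _)%N]big1 // addn0 [X in _ = (X + _)%N]big_mkcond /=.
by congr (_ + _)%N; apply: eq_bigr => v _; case: (_ \in _).
Qed.

Lemma degree_sejoin_right (t : G2) :
  @degree J (inr t) = (#|edge G1| + degree t)%N.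
Proof.
rewrite [LHS]degreeE (degreeE t) !big_sumType /= sum1_card.
by rewrite [X in (X + _ + _)%N]big1.
Qed.

(** Places old vertices, inserted vertices and vertices of [G2] in consecutive index ranges,
    independently of how [enum_val] orders the join. *)
Definition sejoin_vertex (k : 'I_(#|G1| + #|edge G1| + #|G2|)) : J :=
  match split k with
  | inl k' => inl (match split k' with
                   | inl i => inl (enum_val i)
                   | inr e => inr (enum_val e)
                   end)
  | inr t => inr (enum_val t)
  end.

Lemma sejoin_vertex_inj : injective sejoin_vertex.
Proof.
move=> i j; rewrite /sejoin_vertex.
case: (split_ordP i) => i' ->; case: (split_ordP j) => j' -> //.
  case: (split_ordP i') => i'' ->; case: (split_ordP j') => j'' -> //.
  - by case=> /enum_val_inj ->.
  - by case=> /enum_val_inj ->.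
by case=> /enum_val_inj ->.
Qed.

Lemma card_sejoin : #|J| = (#|G1| + #|edge G1| + #|G2|)%N.
Proof. by rewrite !card_sum. Qed.

Lemma sejoin_rank_bij : bijective (fun k => enum_rank (sejoin_vertex k) : 'I_#|J|).
Proof.
apply: inj_card_bij; last by rewrite !card_ord card_sejoin.
by move=> i j /enum_rank_inj /sejoin_vertex_inj.
Qed.

Variable R : rcfType.

(** In the subdivision no two old and no two inserted vertices are adjacent, so these diagonal
    blocks hold degrees only. Each vertex of [G2] gains one neighbour per edge of [G1], which shifts
    the argument of its block by [a * #|edge G1|]. *)
Lemma psi_sejoin_block r (alpha : R) (y : {fraction {poly R}}) :
  regular G1 r ->
  let a := ratfunC alpha in
  let B := map_mx (@ratfunC R) (inc_mx R G1) in
  psi (alpha_mx J alpha) y =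
  \det (block_mx
    (block_mx (y - a * r%:R)%:M ((a - 1) *: B)
              ((a - 1) *: B^T) (y - a * (2 + #|G2|)%:R)%:M)
    (col_mx 0 (const_mx (a - 1)))
    (row_mx 0 (const_mx (a - 1)))
    ((y - a * #|edge G1|%:R)%:M - map_mx (@ratfunC R) (alpha_mx G2 alpha))).
Proof.
move=> reg a B; rewrite /psi -(det_mxsub_bij _ sejoin_rank_bij); congr (\det _).
apply/matrixP=> i j; rewrite mxE alpha_resolventE !enum_rankK.
rewrite (inj_eq enum_rank_inj) (inj_eq sejoin_vertex_inj) -/a /sejoin_vertex.
case: (split_ordP i) => i' ->; case: (split_ordP j) => j' ->.
- rewrite block_mxEul (inj_eq (@lshift_inj _ _)).
  case: (split_ordP i') => i'' ->; case: (split_ordP j') => j'' ->.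
  + rewrite block_mxEul mxE (inj_eq (@lshift_inj _ _)) degree_sejoin_old reg.
    by rewrite mulr0 addr0.
  + by rewrite block_mxEur !mxE eq_lrshift mulr0n add0r rmorph_nat.
  + by rewrite block_mxEdl !mxE eq_rlshift mulr0n add0r rmorph_nat.
  + rewrite block_mxEdr mxE (inj_eq (@rshift_inj _ _)) degree_sejoin_inserted.
    by rewrite mulr0 addr0.
- rewrite block_mxEur eq_lrshift mulr0n add0r.
  case: (split_ordP i') => i'' ->.
    by rewrite col_mxEu mxE mulr0.
  by rewrite col_mxEd mxE mulr1.
- rewrite block_mxEdl eq_rlshift mulr0n add0r.
  case: (split_ordP j') => j'' ->.
    by rewrite row_mxEl mxE mulr0.
  by rewrite row_mxEr mxE mulr1.
- rewrite block_mxEdr alpha_resolventE (inj_eq (@rshift_inj _ _)) -/a.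
  rewrite degree_sejoin_right natrD /=; case: eqP => _; last by [].
  by rewrite !mulr1n; ring.
Qed.

End BlockForm.

(** * Determinant of the block matrix, and the scalar identities of the factorisation *)

Lemma det_join_block (F : fieldType) n m k (p q c : F)
    (B : 'M_(n, m)) (M : 'M_k) :
  p != 0 -> M \in unitmx ->
  \det (block_mx
    (block_mx p%:M (c *: B) (c *: B^T) q%:M)
    (col_mx 0 (const_mx c)) (row_mx 0 (const_mx c)) M) =
  \det M * (p ^+ n * \det (q%:M - p^-1 *: ((c *: B^T) *m (c *: B)) -
    const_mx (c ^+ 2 * ((const_mx 1 : 'cV_k)^T *m invmx M *m
                        (const_mx 1 : 'cV_k)) 0 0))).
Proof.
move=> p0 Mu; rewrite det_schur_dr //; congr (_ * _).
set g := _ 0 0.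
(* The zero blocks confine the correction to the inserted vertices, where every entry is [c ^+ 2]
   times the sum of all entries of [invmx M]. *)
have -> : col_mx 0 (const_mx c) *m invmx M *m row_mx 0 (const_mx c) =
    block_mx 0 0 0 (const_mx (c ^+ 2 * g)) :> 'M_(n + m).
  rewrite mul_col_mx mul_col_row !mul0mx !mulmx0; congr block_mx.
  apply/matrixP=> i j; rewrite /g !mxE mulr_sumr; apply: eq_bigr => l _.
  rewrite !mxE mulr1 expr2 -mulrA mulrC; congr (_ * _).
  by rewrite mulr_sumr; apply: eq_bigr => h _; rewrite !mxE mul1r.
rewrite opp_block_mx add_block_mx !oppr0 !addr0 det_schur_ul //.
by rewrite addrAC.
Qed.

(** A matrix of order 1 is its own row sum. The order is a variable with an equation because it will
    be the cardinality of an edge type. *)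
Lemma det_of_const_sum (F : fieldType) m (N : 'M[F]_m) s :
  m = 1%N -> N *m const_mx 1 = const_mx s :> 'M_(m, m) -> \det N = s.
Proof.
move=> m1; subst m => /matrixP/(_ 0 0); rewrite !mxE big_ord1 mxE mulr1 => <-.
by rewrite det_mx11.
Qed.

(** Trades the adjacency matrix [A] for [A_alpha], by substituting [(1 - a) A = A_alpha - a r] in
    [(1 - a) ^+ 2 A]. *)
Lemma scalar_sub_incidence (F : fieldType) n (A : 'M[F]_n) (p q a r : F) :
  (p * q)%:M - ((a - 1) * (a - 1)) *: (r%:M + A) =
  (p * q - (1 - a) ^+ 2 * r + (1 - a) * a * r)%:M -
  (1 - a) *: ((a * r)%:M + (1 - a) *: A).
Proof.
by apply/matrixP=> i j; rewrite !mxE; case: eqP => _; rewrite ?mulr1n ?mulr0n; ring.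
Qed.

(** Expands the product [p q] into the quadratic in [x] of the final formula; [spectral_factorE]
    does the same for the remaining eigenvalues. *)
Lemma principal_factorE (F : comPzRingType) (x a n r m g : F) :
  (x - a * r) * (x - 2 * a - a * n) - 2 * r * (1 - a) ^+ 2 -
    m * (1 - a) ^+ 2 * (x - a * r) * g =
  x ^+ 2 - a * (2 + r + n) * x + r * (a ^+ 2 * n + 4 * a - 2) -
    m * (1 - a) ^+ 2 * (x - a * r) * g.
Proof. by ring. Qed.

Lemma spectral_factorE (F : comPzRingType) (x a n r l : F) :
  (x - a * r) * (x - 2 * a - a * n) - (1 - a) ^+ 2 * r + (1 - a) * a * r -
    (1 - a) * l =
  x ^+ 2 - a * (2 + r + n) * x + r * (a ^+ 2 * n + 3 * a - 1) - (1 - a) * l.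
Proof. by ring. Qed.

Lemma sub_div_neq0 (F : fieldType) (p q k : F) :
  p != 0 -> p * q - k != 0 -> q - k / p != 0.
Proof.
move=> p0; apply: contraNneq => s0.
by rewrite -(divfK p0 k) (mulrC (k / p)) -mulrBr s0 mulr0.
Qed.

Lemma K2_factorisation (F : fieldType) (x a n g P : F) :
  x - a != 0 ->
  P * ((x - a) ^+ 2 * (x - a * (2 + n) - 2 * (a - 1) ^+ 2 / (x - a) -
    (a - 1) ^+ 2 * g)) =
  (x - a) * P * (x ^+ 2 - a * (3 + n) * x + (a ^+ 2 * n + 4 * a - 2) -
    (1 - a) ^+ 2 * (x - a) * g).
Proof. by move=> p0; field. Qed.

(** The factor of the eigenvalue [r] is [p q - 2 r (1 - a) ^+ 2], that is, [p] times the row sum of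
    the Schur complement. It cancels the denominator of the rank-one factor and leaves the Gamma
    factor. Here [D] stands for the determinant of the Schur complement, [Q] for the remaining power
    of [q], and [S] for the product over the other eigenvalues. *)
Lemma join_factorisation (F : fieldType) (p q a r g m P pn D Q S : F) :
  p != 0 -> p * q - 2 * r * (a - 1) ^+ 2 != 0 ->
  pn * D = Q * ((p * q - (1 - a) ^+ 2 * r + (1 - a) * a * r - (1 - a) * r) * S) ->
  P * (pn * (D * (1 - (a - 1) ^+ 2 * g / (q - 2 * r * (a - 1) ^+ 2 / p) * m))) =
  Q * P * (p * q - 2 * r * (1 - a) ^+ 2 - m * (1 - a) ^+ 2 * p * g) * S.
Proof.
move=> p0 pq0; rewrite [pn * (D * _)]mulrA => ->; field.
by rewrite p0 mulrC pq0.
Qed.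

(** For nonzero [b] this evaluates the characteristic polynomial at [y / b]. The case [b = 0] is
    separate because [b] will be [1 - a], which vanishes for [alpha = 1]. *)
Lemma det_scale_spectrum (F : fieldType) n (A : 'M[F]_n) (s : seq F) (y b : F) :
  char_poly A = \prod_(l <- s) ('X - l%:P) ->
  \det (y%:M - b *: A) = \prod_(l <- s) (y - b * l).
Proof.
move=> sA.
have ns : size s = n.
  by apply: succn_inj; rewrite -(size_char_poly A) sA size_prod_XsubC.
have [->|b0] := eqVneq b 0.
  rewrite scale0r subr0 det_scalar -ns; under eq_bigr do rewrite mul0r subr0.
  by rewrite big_const_seq count_predT iter_mulr_1.
have -> : y%:M - b *: A = b *: ((y / b)%:M - A).
  by rewrite scalerBr scale_scalar_mx mulrC divfK.
rewrite detZ; have -> : \det ((y / b)%:M - A) = (char_poly A).[y / b].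
  rewrite /char_poly -horner_evalE -det_map_mx; congr (\det _).
  by apply/matrixP=> i j; rewrite !mxE rmorphB rmorphMn /= /horner_eval hornerX hornerC.
have -> : b ^+ n = \prod_(l <- s) b by rewrite big_const_seq count_predT iter_mulr_1 ns.
rewrite sA horner_prod -big_split /=; apply: eq_bigr => l _.
by rewrite hornerXsubC mulrBr [b * (y / b)]mulrC divfK.
Qed.

(** * The largest eigenvalue of [A_alpha] of a regular graph *)

Section Spectrum.
Variables (R : rcfType) (G : sgraph) (alpha : R) (r : nat).
Hypotheses (alpha01 : 0 <= alpha <= 1) (reg : regular G r).

Lemma alpha_mx_regular :
  alpha_mx G alpha = (alpha * r%:R)%:M + (1 - alpha) *: adj_mx R G.
Proof. by rewrite /alpha_mx (deg_mx_regular R reg) scale_scalar_mx. Qed.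

(** The bounds on [alpha] enter here: nonnegative entries make a column sum a sum of absolute
    values, as the Gershgorin bound requires. *)
Lemma alpha_mx_ge0 i j : 0 <= alpha_mx G alpha i j.
Proof.
have /andP[a0 a1] := alpha01.
rewrite alpha_mx_regular !mxE addr_ge0 ?mulrn_wge0 ?mulr_ge0 ?ler0n ?subr_ge0 //.
Qed.

(** Columns are summed because [eigenvalue] refers to row vectors multiplied from the left. *)
Lemma alpha_mx_colsum j : \sum_i alpha_mx G alpha i j = r%:R.
Proof.
rewrite alpha_mx_regular; under eq_bigr do rewrite !mxE.
rewrite big_split /= -mulr_sumr -natr_sum.
rewrite (bigD1 j) //= eqxx mulr1n big1 => [|i /negPf ->]; last by rewrite mulr0n.
rewrite addr0 (sum_enum_val (fun v : G => adj v (enum_val j) : nat)).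
have -> : (\sum_(v : G) adj v (enum_val j))%N = r.
  by rewrite -(reg (enum_val j)) degreeE; apply: eq_bigr => v _; rewrite adj_sym.
by ring.
Qed.

(* Gershgorin: compare the entries of an eigenvector with its largest one. *)
Lemma alpha_mx_eigenvalue_max l :
  eigenvalue (alpha_mx G alpha) l -> l <= r%:R.
Proof.
case/eigenvalueP=> v vA /rV0Pn[k vk].
pose j := [arg max_(j > k) `|v 0 j|]%O.
have jmax i : `|v 0 i| <= `|v 0 j|.
  by rewrite /j; case: arg_maxP => // j' _; apply.
have vj : 0 < `|v 0 j| by apply: lt_le_trans (jmax k); rewrite normr_gt0.
rewrite (le_trans (ler_norm _)) // -(ler_pM2r vj) -normrM.
have -> : l * v 0 j = \sum_i v 0 i * alpha_mx G alpha i j.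
  by move/matrixP/(_ 0 j): vA; rewrite !mxE.
rewrite -(alpha_mx_colsum j) mulr_suml (le_trans (ler_norm_sum _ _ _)) //.
apply: ler_sum => i _; rewrite normrM (ger0_norm (alpha_mx_ge0 i j)) mulrC.
by rewrite ler_wpM2l ?alpha_mx_ge0.
Qed.

Lemma alpha_mx_eigenvalue_regular : (0 < #|G|)%N ->
  eigenvalue (alpha_mx G alpha) r%:R.
Proof.
move=> G0; apply/eigenvalueP; exists (const_mx 1).
  apply/matrixP=> i j; rewrite !mxE mulr1 -(alpha_mx_colsum j).
  by apply: eq_bigr => k _; rewrite mxE mul1r.
by apply/rV0Pn; exists (Ordinal G0); rewrite mxE oner_eq0.
Qed.

(** As [r] is an eigenvalue and bounds all the others, it heads the nonincreasing list; the tail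
    carries the eigenvalues of index at least 2. *)
Lemma spectrum_regular s : (0 < #|G|)%N ->
  is_spectrum (alpha_mx G alpha) s -> s = r%:R :: behead s.
Proof.
move=> G0 [ss sA].
have sP l : (l \in s) = eigenvalue (alpha_mx G alpha) l.
  by rewrite eigenvalue_root_char sA root_prod_XsubC.
have := alpha_mx_eigenvalue_regular G0; rewrite -sP.
case: s ss sA sP => // l0 t /= ss sA sP rs; congr (_ :: _).
apply/eqP; rewrite eq_le alpha_mx_eigenvalue_max -?sP ?mem_head //=.
move: rs; rewrite inE => /orP[/eqP->//|rt].
have getr : transitive (>=%R : rel R) by move=> a b c ba cb; apply: le_trans cb ba.
by have /allP := order_path_min getr ss; apply.
Qed.

End Spectrum.

(** * The characteristic function of the join *)

Section JoinPsi.
Variables (R : rcfType) (G1 G2 : sgraph) (r : nat) (alpha : R).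
Hypothesis reg : regular G1 r.
Local Notation F := {fraction {poly R}}.
Local Notation x := (ratfunX R).
Local Notation a := (ratfunC alpha).
Local Notation m := #|edge G1|.
Local Notation p := (x - a * r%:R).
Local Notation q := (x - a * (2 + #|G2|)%:R).
Local Notation B := (map_mx (@ratfunC R) (inc_mx R G1)).
Local Notation N :=
  (q%:M - p^-1 *: (((a - 1) *: B^T) *m ((a - 1) *: B))).
Local Notation gam := (Gamma (alpha_mx G2 alpha) (x - a * m%:R)).

Lemma ratfunX_sub_neq0 (c : R) : x - ratfunC c != 0.
Proof. by rewrite -rmorphB tofrac_eq0 polyXsubC_eq0. Qed.

(** A product of two monic linear polynomials has degree 2 and cannot equal a constant. *)
Lemma ratfunX_quadratic_neq0 (c d e : R) :
  (x - ratfunC c) * (x - ratfunC d) - ratfunC e != 0.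
Proof.
rewrite -!rmorphB -rmorphM -rmorphB tofrac_eq0 subr_eq0.
apply/eqP => /(congr1 (size : {poly R} -> nat)).
rewrite size_mul ?polyXsubC_eq0 // !size_XsubC size_polyC.
by case: eqP.
Qed.

Lemma ratfunC_natM k : a * k%:R = ratfunC (alpha * k%:R).
Proof. by rewrite rmorphM rmorph_nat. Qed.

Lemma psi_sejoin :
  psi (alpha_mx (sejoin G1 G2) alpha) x =
  psi (alpha_mx G2 alpha) (x - a * m%:R) *
  (p ^+ #|G1| * \det (N - const_mx ((a - 1) ^+ 2 * gam))).
Proof.
rewrite (psi_sejoin_block _ _ _ reg) det_join_block //.
  by rewrite ratfunC_natM ratfunX_sub_neq0.
by rewrite ratfunC_natM resolvent_unit.
Qed.

Lemma schur_mul_const :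
  N *m const_mx 1 = const_mx (q - 2 * r%:R * (a - 1) ^+ 2 / p) :> 'M_(m, m).
Proof.
(* Writing the all-ones matrix as an image under [ratfunC] lets the incidence products be computed
   over [R]. *)
have -> : const_mx 1 = map_mx (@ratfunC R) (const_mx 1) :> 'M_(m, m).
  by apply/matrixP=> i j; rewrite !mxE rmorph1.
rewrite mulmxBl mul_scalar_mx map_trmx !(=^~ scalemxAl, =^~ scalemxAr) -mulmxA.
rewrite -!map_mxM.
rewrite (inc_mul_const _ _ reg) tr_inc_mul_const.
apply/matrixP=> i j; rewrite !mxE !rmorphM rmorph1 !rmorph_nat /=.
by ring.
Qed.

Lemma schur_sub_const_mul (g : F) :
  (N - const_mx g) *m const_mx 1 =
  const_mx (q - 2 * r%:R * (a - 1) ^+ 2 / p - g * m%:R) :> 'M_(m, m).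
Proof.
rewrite mulmxBl schur_mul_const; apply/matrixP=> i j; rewrite !mxE.
under eq_bigr do rewrite !mxE mulr1.
by rewrite sumr_const card_ord -[g *+ m]mulr_natr.
Qed.

Lemma schur_det (s : seq R) :
  char_poly (alpha_mx G1 alpha) = \prod_(l <- s) ('X - l%:P) ->
  q ^+ #|G1| * (p ^+ #|G1| * \det N) =
  q ^+ m * \prod_(l <- s)
    (p * q - (1 - a) ^+ 2 * r%:R + (1 - a) * a * r%:R - (1 - a) * ratfunC l).
Proof.
move=> sA; rewrite det_scalar_sub_mulC; last 2 first.
- by rewrite ratfunC_natM ratfunX_sub_neq0.
- by rewrite ratfunC_natM ratfunX_sub_neq0.
(* The factorisation is moved to the field of rational functions, since the scalars multiplying the
   matrix live there. *)
have sA' : char_poly (map_mx (@ratfunC R) (alpha_mx G1 alpha)) =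
    \prod_(l <- map (@ratfunC R) s) ('X - l%:P).
  rewrite -map_char_poly sA rmorph_prod big_map; apply: eq_bigr => l _.
  exact: map_polyXsubC.
congr (_ * _); rewrite -(big_map (@ratfunC R) xpredT (fun l => _ - _ * l)).
rewrite -(det_scale_spectrum _ _ sA'); congr (\det _).
rewrite -scalemxAl -scalemxAr scalerA map_trmx -map_mxM inc_mul_tr.
rewrite (deg_mx_regular R reg) (alpha_mx_regular alpha reg).
rewrite !map_mxD !map_scalar_mx map_mxZ /= -ratfunC_natM rmorphB rmorph1 rmorph_nat.
exact: scalar_sub_incidence.
Qed.

Lemma psi_sejoin_spectrum (s : seq R) :
  (#|G1| <= m)%N ->
  char_poly (alpha_mx G1 alpha) = \prod_(l <- r%:R :: s) ('X - l%:P) ->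
  psi (alpha_mx (sejoin G1 G2) alpha) x =
  q ^+ (m - #|G1|) * psi (alpha_mx G2 alpha) (x - a * m%:R) *
  (p * q - 2 * r%:R * (1 - a) ^+ 2 - m%:R * (1 - a) ^+ 2 * p * gam) *
  \prod_(l <- s)
    (p * q - (1 - a) ^+ 2 * r%:R + (1 - a) * a * r%:R - (1 - a) * ratfunC l).
Proof.
move=> nm /schur_det.
have p0 : p != 0 by rewrite ratfunC_natM ratfunX_sub_neq0.
have q0 : q != 0 by rewrite ratfunC_natM ratfunX_sub_neq0.
have pq0 : p * q - 2 * r%:R * (a - 1) ^+ 2 != 0.
  have -> : 2 * r%:R * (a - 1) ^+ 2 = ratfunC (2 * r%:R * (alpha - 1) ^+ 2).
    by rewrite !rmorphM /= rmorphB rmorph1 !rmorph_nat.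
  by rewrite !ratfunC_natM ratfunX_quadratic_neq0.
have s0 : q - 2 * r%:R * (a - 1) ^+ 2 / p != 0 := sub_div_neq0 p0 pq0.
(* With at least as many edges as vertices, [q ^+ #|G1|] splits off and cancels from both sides of
   [schur_det]. *)
have qm : q ^+ m = q ^+ #|G1| * q ^+ (m - #|G1|) by rewrite -exprD subnKC.
rewrite big_cons qm -mulrA.
move/(mulfI (expf_neq0 _ q0)); rewrite rmorph_nat => detN.
rewrite psi_sejoin (det_sub_const _ s0 schur_mul_const).
exact: (join_factorisation gam _ _ p0 pq0 detN).
Qed.
End JoinPsi.

Theorem theorem2 (R : rcfType) (G1 G2 : sgraph) (r1 n1 m1 n2 : nat)
    (G1_connected : connected_graph G1) (G2_connected : connected_graph G2)
    (G1_regular : regular G1 r1)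
    (card_G1 : #|G1| = n1) (edges_G1 : #|edge_set G1| = m1)
    (card_G2 : #|G2| = n2) :
  let x := ratfunX R in
  (r1 = 1%N ->
   forall alpha : R, 0 <= alpha <= 1 ->
   let a := ratfunC alpha in
   psi (alpha_mx (sejoin G1 G2) alpha) x =
     (x - a) * psi (alpha_mx G2 alpha) (x - a) *
     (x ^+ 2 - a * (3 + n2%:R) * x + (a ^+ 2 * n2%:R + 4 * a - 2)
      - (1 - a) ^+ 2 * (x - a) * Gamma (alpha_mx G2 alpha) (x - a)))
  /\
  ((2 <= r1)%N ->
   forall alpha : R, 0 <= alpha <= 1 ->
   forall lambda : seq R, is_spectrum (alpha_mx G1 alpha) lambda ->
   let a := ratfunC alpha in
   psi (alpha_mx (sejoin G1 G2) alpha) x =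
     (x - 2 * a - a * n2%:R) ^+ (m1 - n1) *
     psi (alpha_mx G2 alpha) (x - a * m1%:R) *
     (x ^+ 2 - a * (2 + r1%:R + n2%:R) * x
      + r1%:R * (a ^+ 2 * n2%:R + 4 * a - 2)
      - m1%:R * (1 - a) ^+ 2 * (x - a * r1%:R) *
        Gamma (alpha_mx G2 alpha) (x - a * m1%:R)) *
     \prod_(2 <= i < n1.+1)
       (x ^+ 2 - a * (2 + r1%:R + n2%:R) * x
        + r1%:R * (a ^+ 2 * n2%:R + 3 * a - 1)
        - (1 - a) * ratfunC lambda`_(i.-1))).
Proof.
move: card_G1 edges_G1 card_G2; rewrite -card_edges => <- <- <- {n1 m1 n2} x.
split=> [r1E|r1_ge2] alpha alpha01.
- move=> a; rewrite r1E in G1_regular.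
  (* Here [#|G1|] is 2 and there is 1 edge, so the power of [q] could not be split as in the other
     case; the determinant of order 1 is read off from its row sum instead. *)
  have [G1_2 E1] := connected_1_regular G1_connected G1_regular.
  rewrite (psi_sejoin _ _ G1_regular).
  rewrite (det_of_const_sum E1 (schur_sub_const_mul _ _ G1_regular _)).
  have p0 : x - a != 0 by apply: ratfunX_sub_neq0.
  rewrite G1_2 E1 natrD -/x -/a !mulr1.
  exact: K2_factorisation.
move=> lambda spec a.
have lambdaE := spectrum_regular alpha01 G1_regular (proj1 G1_connected) spec.
have [_ charE] := spec; rewrite lambdaE in charE.
rewrite (psi_sejoin_spectrum _ G1_regular (card_le_edges r1_ge2 G1_regular) charE).
have size_lambda : size (behead lambda) = #|G1|.-1.
  apply/eqP; rewrite -eqSS prednK ?(proj1 G1_connected) //.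
  rewrite -[_.+1]/(size (r1%:R :: behead lambda)) -eqSS.
  by rewrite -(size_prod_XsubC _ id) -charE size_char_poly.
(* Two shifts bring the range from 2 to [#|G1|] down to start at 0. The entry of [lambda] at the
   shifted [i.-1] is then entry [i.+1], which is entry [i] of the tail. *)
rewrite (big_nth 0) size_lambda !big_add1 natrD -/x -/a.
have -> : x - a * (2 + #|G2|%:R) = x - 2 * a - a * #|G2|%:R.
  by rewrite mulrDr opprD addrA [a * 2]mulrC.
rewrite principal_factorE; congr (_ * _); apply: eq_bigr => i _.
by rewrite spectral_factorE [in RHS]lambdaE.
Qed.
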